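(* Let $\Lambda_0\subset\mathbb{R}^n$ be an $n$-dimensional lattice of density $\beta=e^{n\delta}$, used over an additive circularly-symmetric noise (ACSN) channel whose noise norm $\|z\|$ has density $f_{\|z\|}$. For $r>0$ define $$\alpha(r)=\inf_{\alpha'\in\mathcal{A}_{2r}}\ \sup_{0<x\le 2e^{\delta}r}\alpha'(x).$$ Then the error probability of the maximum-likelihood (nearest-lattice-point) decoder satisfies, for every $r>0$, $$P_e(\Lambda_0)\le \alpha(r)\,\beta V_n\int_0^{r}f_{\|z\|}(\rho)\rho^n\,d\rho+\int_r^\infty f_{\|z\|}(\rho)\,d\rho,$$ and hence $P_e(\Lambda_0)$ is at most the minimum over $r$ of the right-hand side.
   Context: An ACSN channel: the receiver observes $y=\lambda+z$, where $\lambda$ is the transmitted lattice point and $z\in\mathbb{R}^n$ is noise whose distribution is isotropic (invariant under orthogonal maps) with density a non-increasing function of $\|z\|$; $f_{\|z\|}$ is the density of $\|z\|$. The ML decoder errs when $z$ is not in the Voronoi cell $\{y:\|y\|<\|y-\lambda\|\ \forall\lambda\in\Lambda_0\setminus\{0\}\}$ of $0$; $P_e(\Lambda_0)$ is this probability. $V_n$ is the volume of the unit $n$-ball, $\beta=1/\det\Lambda_0$, $\delta=\frac1n\ln\beta$. The distance series $0<\lambda_1<\lambda_2<\cdots$ lists the distinct norms of nonzero lattice vectors, $\mathcal{N}_j=\#\{\lambda\in\Lambda_0:\|\lambda\|=\lambda_j\}$, and $\widetilde\lambda_j=e^{\delta}\lambda_j$. For $L>0$, $\mathcal{A}_L$ is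 the set of functions $\alpha'(x)=N'(x)/(nV_nx^{n-1})$ ($x>0$), where $N'\ge0$ is a locally integrable function on $(0,\infty)$ with $\sum_{j:\widetilde\lambda_j\le t}\mathcal{N}_j\le\int_0^tN'(x)\,dx$ for all $t\in(0,e^{\delta}L]$. (In the paper, $\alpha(r)=\max_{x\le 2e^{\delta}r}\alpha^{\mathrm{opt}}(x)$ with $\alpha^{\mathrm{opt}}$ a minimizer of this min–max problem.) *)

(* Defs.v *)
From HB Require Import structures.
From mathcomp Require Import all_boot all_order all_algebra.
From mathcomp Require Import all_classical all_reals all_analysis.
Set Implicit Arguments. Unset Strict Implicit. Unset Printing Implicit Defensive.
Import Order.TTheory GRing.Theory Num.Theory.
Import numFieldNormedType.Exports.
Local Open Scope classical_set_scope.
Local Open Scope ring_scope.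

Section ACSN.
Context {R : realType}.

Fixpoint unit_ball_vol (n : nat) : R :=
  match n with
  | 0 => 1
  | 1 => 2
  | m.+2 => (2 * pi / (m.+2)%:R) * unit_ball_vol m
  end.

Definition enorm {n : nat} (x : 'rV[R]_n) : R :=
  Num.sqrt (\sum_(i < n) x ord0 i ^+ 2).

Definition lattice {n : nat} (B : 'M[R]_n) : set 'rV[R]_n :=
  [set v *m B | v in [set v : 'rV[R]_n | forall i, v ord0 i \is a Num.int]].

Definition voronoi0 {n : nat} (B : 'M[R]_n) : set 'rV[R]_n :=
  [set y | forall l, lattice B l -> l != 0 -> enorm y < enorm (y - l)].

Definition lat_beta {n : nat} (B : 'M[R]_n) : R := (`|\det B|)^-1.
Definition lat_delta {n : nat} (B : 'M[R]_n) : R := ln (lat_beta B) / n%:R.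
Definition edelta {n : nat} (B : 'M[R]_n) : R := expR (lat_delta B).

(* sum_{j : ~lambda_j <= t} N_j = number of nonzero lattice points
   with e^delta * ||lambda|| <= t. *)
Definition count_upto {n : nat} (B : 'M[R]_n) (t : R) : \bar R :=
  \esum_(l in [set l | lattice B l /\ l != 0 /\ edelta B * enorm l <= t]) 1%E.

Definition admissible_Nprime {n : nat} (B : 'M[R]_n) (L : R) (N' : R -> R) : Prop :=
  [/\ measurable_fun (`]0, +oo[ : set R) N',
      (forall x, 0 < x -> 0 <= N' x),
      (forall a b, 0 < a ->
          (@lebesgue_measure R).-integrable `[a, b] (EFin \o N')) &
      (forall t, 0 < t -> t <= edelta B * L ->
          (count_upto B t <= \int[lebesgue_measure]_(x in `]0%R, t]) (N' x)%:E)%E)].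

Definition alpha_prime (n : nat) (N' : R -> R) (x : R) : R :=
  N' x / (n%:R * unit_ball_vol n * x ^+ n.-1).

Definition alpha_r {n : nat} (B : 'M[R]_n) (r : R) : \bar R :=
  ereal_inf [set ereal_sup [set (alpha_prime n N' x)%:E | x in `]0, 2 * edelta B * r]]
            | N' in admissible_Nprime B (2 * r)].

Definition pe_bound {n : nat} (B : 'M[R]_n) (f : R -> R) (r : R) : \bar R :=
  (alpha_r B r * ((lat_beta B * unit_ball_vol n)%:E *
      \int[lebesgue_measure]_(x in `[0%R, r]) (f x * x ^+ n)%:E)
   + \int[lebesgue_measure]_(x in (`[r, +oo[ : set R)) (f x)%:E)%E.

End ACSN.

(* Main.v *)
Require Import Defs.
From HB Require Import structures.
From mathcomp Require Import all_boot all_order all_algebra.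
From mathcomp Require Import all_classical all_reals all_analysis.
From mathcomp Require Import measurable_realfun ring lra.
Set Implicit Arguments.
Unset Strict Implicit.
Unset Printing Implicit Defensive.
Import Order.TTheory GRing.Theory Num.Theory.
Import numFieldNormedType.Exports.
Local Open Scope classical_set_scope.
Local Open Scope ring_scope.

(* Errors with [|z| > r] are covered by the tail of [f]. If the decoder errs with
   [|z| <= r], then [|z - l| <= |z|] for some nonzero lattice vector [l]. By
   isotropy this event keeps its probability when [l] is replaced by [|l| u] for a
   fixed unit vector [u], and it then reads [|l| <= 2 <z, u>_+]. Summing over [l]
   and exchanging sum and expectation bounds the error by the expected number of
   nonzero lattice vectors of norm at most [2 <z, u>_+], hence by
   [sup alpha' * beta * V_n * E[(2 <z, u>_+)^n; |z| <= r]]. The same exchange, with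
   Lebesgue measure on [R^n] in place of the counting measure of the lattice,
   compares the ball [{x : |z - x| <= |z|}] with the centred ball of radius
   [2 <z, u>_+], so that this last expectation is exactly [E[|z|^n; |z| <= r]]. Only
   the behaviour of Lebesgue measure under translations and homotheties is needed,
   not polar coordinates. *)

Lemma measurable_ler_set d (T : measurableType d) (R : realType) (f g : T -> R) :
  measurable_fun setT f -> measurable_fun setT g -> measurable [set t | f t <= g t].
Proof.
by move=> mf mg; rewrite -[X in measurable X]setTI; exact: measurable_fun_le.
Qed.

Section measure_of_sections.
Context d d' (T : measurableType d) (T' : measurableType d') (R : realType).
Variables (m : {sigma_finite_measure set T -> \bar R}).
Variables (m' : {sigma_finite_measure set T' -> \bar R}).
Variables (Z : set T) (J : set T') (E : T -> T' -> Prop).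
Hypotheses (mZ : measurable Z) (mJ : measurable J).
Hypothesis mE : measurable [set p | E p.1 p.2].

Let A : set (T * T') := Z `*` J `&` [set p | E p.1 p.2].

Let mA : measurable A.
Proof. by apply: measurableI => //; exact: measurableX. Qed.

Let restrict_xsection : (fun t => m' (J `&` [set x | E t x])) \_ Z = m' \o xsection A.
Proof.
apply/funext => t; rewrite patchE /= xsectionE; case: ifPn => [/set_mem Zt|/negP Zt].
  by congr (m' _); apply/seteqP; split=> x [] // [].
by rewrite [X in m' X](_ : _ = set0) ?measure0 // -subset0 => x [[/mem_set]].
Qed.

Let restrict_ysection : (fun x => m (Z `&` [set t | E t x])) \_ J = m \o ysection A.
Proof.
apply/funext => x; rewrite patchE /= ysectionE; case: ifPn => [/set_mem Jx|/negP Jx].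
  by congr (m _); apply/seteqP; split=> t [] // [].
by rewrite [X in m X](_ : _ = set0) ?measure0 // -subset0 => t [[_ /mem_set]].
Qed.

Lemma measurable_fun_measure_section :
  measurable_fun Z (fun t => m' (J `&` [set x | E t x])).
Proof.
apply/(measurable_restrictT _ mZ); rewrite restrict_xsection.
exact: measurable_fun_xsection.
Qed.

Lemma integral_measure_section :
  (\int[m]_(t in Z) m' (J `&` [set x | E t x]) =
   \int[m']_(x in J) m (Z `&` [set t | E t x]))%E.
Proof.
rewrite integral_mkcond restrict_xsection [RHS]integral_mkcond restrict_ysection.
by rewrite -indic_fubini_tonelli_FE // -indic_fubini_tonelli_GE // indic_fubini_tonelli.
Qed.

End measure_of_sections.

Lemma ge0_integral_density d (T : measurableType d) (R : realType)
    (nu : {finite_measure set T -> \bar R})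
    (mu : {sigma_finite_measure set T -> \bar R}) (f g : T -> \bar R) (D : set T) :
  measurable_fun setT f -> (forall x, 0 <= f x)%E ->
  (forall A, measurable A -> nu A = \int[mu]_(x in A) f x)%E ->
  measurable D -> measurable_fun D g -> (forall x, D x -> 0 <= g x)%E ->
  (\int[nu]_(x in D) g x = \int[mu]_(x in D) (f x * g x))%E.
Proof.
move=> mf f0 nuE mD mg g0.
have nu_mu : nu `<< mu.
  apply/null_content_dominatesP => A mA A0; rewrite nuE //.
  rewrite -(integral_abs_eq0 mA (measurable_funTS mf) A0).
  by apply: eq_integral => x _; rewrite gee0_abs.
have abs_g x : x \in D -> g x = `|g x|%E by move=> /set_mem Dx; rewrite gee0_abs ?g0.
have mabs_g : measurable_fun D (fun x => `|g x|%E) by exact: measurableT_comp.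
rewrite (eq_integral _ _ abs_g).
rewrite -(Radon_Nikodym_SigmaFinite.change_of_variables nu_mu) //.
have int_RN := Radon_Nikodym_SigmaFinite.f_integrable nu_mu.
have mRN := measurable_funTS (measurable_int _ int_RN).
have RN_f : ae_eq mu D (Radon_Nikodym_SigmaFinite.f nu mu) f.
  apply: integral_ae_eq => //; first exact: integrableS int_RN.
    exact: measurable_funTS.
  move=> A _ mA; rewrite -nuE //.
  exact/esym/Radon_Nikodym_SigmaFinite.f_integral.
under [RHS]eq_integral => x xD do rewrite muleC abs_g //.
apply: ae_eq_integral => //.
- exact: emeasurable_funM.
- by apply: emeasurable_funM => //; exact: measurable_funTS.
- exact: ae_eqe_mul2l.
Qed.

Lemma ge0_integral_mul_eq0 d (T : measurableType d) (R : realType)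
    (mu : {measure set T -> \bar R}) (D : set T) (f w : T -> R) :
  measurable D -> measurable_fun D f -> measurable_fun D w ->
  (forall x, D x -> 0 <= f x) -> (forall x, D x -> 0 < w x) ->
  (\int[mu]_(x in D) (f x * w x)%:E = 0)%E ->
  (\int[mu]_(x in D) (f x)%:E = 0)%E.
Proof.
move=> mD mf mw f0 w0 fw0.
have mfE : measurable_fun D (EFin \o f) by exact/measurable_EFinP.
have mfwE : measurable_fun D (fun x => (f x * w x)%:E).
  by apply/measurable_EFinP; exact: measurable_funM.
have abs_fw0 : (\int[mu]_(x in D) `|(f x * w x)%:E| = 0)%E.
  rewrite -[RHS]fw0; apply: eq_integral => x /set_mem Dx.
  by rewrite gee0_abs // lee_fin mulr_ge0 ?f0 // ltW ?w0.
have /(ae_eq_integral_abs _ mD mfwE) fw_ae0 := abs_fw0.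
rewrite (ae_eq_integral (cst 0%E)) ?integral0 //.
apply: filterS fw_ae0 => x + Dx => /(_ Dx) [] /eqP.
by rewrite mulf_eq0 (gt_eqF (w0 x Dx)) orbF => /eqP ->.
Qed.

Definition truncated_moment (R : realType) (f : R -> R) (k : nat) (r : R) : \bar R :=
  (\int[lebesgue_measure]_(x in `[0%R, r]) (f x * x ^+ k)%:E)%E.

Section density.
Context d (T : measurableType d) (R : realType) (P : probability T R).
Variables (X : T -> R) (f : R -> R).
Hypotheses (measurable_X : measurable_fun setT X).
Hypotheses (mf : measurable_fun setT f) (f_ge0 : forall x, 0 <= f x).
Hypothesis X_density : forall S : set R, measurable S ->
  P (X @^-1` S) = (\int[lebesgue_measure]_(x in S) (f x)%:E)%E.

Let mX (D : set R) : measurable D -> measurable (X @^-1` D).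
Proof. by move=> mD; rewrite -[X @^-1` D]setTI; exact: measurable_X. Qed.

Lemma integral_comp_density (D : set R) (g : R -> \bar R) :
  measurable D -> measurable_fun D g -> (forall x, D x -> 0 <= g x)%E ->
  (\int[P]_(t in X @^-1` D) g (X t) =
   \int[lebesgue_measure]_(x in D) ((f x)%:E * g x))%E.
Proof.
move=> mD mg g_ge0.
pose X' := @mfun_Sub _ _ T (measurableTypeR R) _ (mem_set measurable_X).
have X'_density (A : set R) : measurable A ->
    distribution P X' A = (\int[lebesgue_measure]_(x in A) (f x)%:E)%E.
  exact: X_density.
transitivity (\int[distribution P X']_(x in D) g x)%E.
  apply/esym/(ge0_integral_pushforward (measurable_funP X')) => // y /set_mem.
  exact: g_ge0.
apply: (ge0_integral_density (nu := distribution P X') (f := EFin \o f)) => //.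
exact/measurable_EFinP.
Qed.

Lemma integral_truncated_moment k r :
  (\int[P]_(t in X @^-1` `[0%R, r]) (X t ^+ k)%:E = truncated_moment f k r)%E.
Proof.
rewrite (integral_comp_density (g := fun x => (x ^+ k)%:E)) //.
  by apply/measurable_EFinP/measurable_funTS; exact: measurable_funX.
by move=> x /=; rewrite in_itv /= => /andP[x_ge0 _]; rewrite lee_fin exprn_ge0.
Qed.

Lemma truncated_moment_ge0 k r : (0 <= truncated_moment f k r)%E.
Proof.
apply: integral_ge0 => x /=; rewrite in_itv /= => /andP[x_ge0 _].
by rewrite lee_fin mulr_ge0 // exprn_ge0.
Qed.

Lemma truncated_moment_fin_num k r : 0 <= r -> truncated_moment f k r \is a fin_num.
Proof.
move=> r_ge0; rewrite ge0_fin_numE ?truncated_moment_ge0 // -integral_truncated_moment.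
apply: (@le_lt_trans _ _ (\int[P]_(t in X @^-1` `[0%R, r]) (r ^+ k)%:E)%E).
  apply: ge0_le_integral => //.
  - exact: mX.
  - by move=> t /=; rewrite in_itv /= => /andP[X_ge0 _]; rewrite lee_fin exprn_ge0.
  - by apply/measurable_EFinP/measurable_funTS; exact: measurable_funX.
  - move=> t /=; rewrite in_itv /= => /andP[X_ge0 Xr].
    by rewrite lee_fin lerXn2r // nnegrE.
rewrite integral_cst; last exact: mX.
rewrite lte_mul_pinfty ?lee_fin ?exprn_ge0 //.
by rewrite (le_lt_trans (probability_le1 _ _)) ?ltry //; exact: mX.
Qed.

Lemma truncated_moment_eq0 k r :
  truncated_moment f k r = 0%E -> P (X @^-1` `[0, r]) = 0%E.
Proof.
have mfx : measurable_fun setT (fun x => f x * x ^+ k).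
  by apply: measurable_funM => //; exact: measurable_funX.
rewrite X_density // /truncated_moment -!integral_itv_obnd_cbnd; last 2 first.
- exact/measurable_EFinP/measurable_funTS.
- exact/measurable_EFinP/measurable_funTS.
apply: ge0_integral_mul_eq0 => //.
- exact: (measurable_funTS mf).
- by move=> x /=; rewrite in_itv /= => /andP[x_gt0 _]; rewrite exprn_gt0.
Qed.

End density.

Lemma lee_ereal_infM (R : realType) (S : set (\bar R)) (x c : \bar R) :
  c \is a fin_num -> (0 < c)%E -> (forall s, S s -> x <= s * c)%E ->
  (x <= ereal_inf S * c)%E.
Proof.
move=> c_fin c_gt0 x_le; rewrite muleC -(fineK c_fin) -ereal_inf_pZl.
  by apply/ereal_infP => _ [s Ss <-]; rewrite fineK // muleC x_le.
by rewrite fine_gt0 // c_gt0 ltey_eq c_fin.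
Qed.

(* [pushforward m f] is a measure only given [mf], which canonical inference
   cannot supply. *)
Definition mpushforward d d' (T : measurableType d) (T' : measurableType d')
    (R : realType) (m : {measure set T -> \bar R}) (f : T -> T')
    (mf : measurable_fun setT f) : {measure set T' -> \bar R}.
Proof. exact: (pushforward m f). Defined.

Lemma sigma_finite_pushforward d d' (T : measurableType d) (T' : measurableType d')
    (R : realType) (m : {measure set T -> \bar R}) (f : T -> T') (g : T' -> T) :
  measurable_fun setT f -> measurable_fun setT g -> cancel f g ->
  sigma_finite setT m -> sigma_finite setT (pushforward m f).
Proof.
move=> mf mg fK [F UF F_fin]; exists (fun k => g @^-1` F k).
  by rewrite -preimage_bigcup -UF preimage_setT.
move=> k; have [mFk Fk_fin] := F_fin k; split.
  by rewrite -[X in measurable X]setTI; exact: mg.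
rewrite /pushforward -comp_preimage (_ : g \o f = id) ?preimage_id //.
exact: funext.
Qed.

Lemma sigma_finite_product_measure d d' (T : measurableType d)
    (T' : measurableType d') (R : realType)
    (m : {sigma_finite_measure set T -> \bar R})
    (m' : {sigma_finite_measure set T' -> \bar R}) :
  sigma_finite setT (m \x m')%E.
Proof.
have [F UF F_fin] := sigma_finiteT m; have [G UG G_fin] := sigma_finiteT m'.
exists (fun k => if unpickle k is Some (i, j) then F i `*` G j else set0).
  apply/esym; rewrite -subTset => -[x y] _.
  have [i _ Fix] : (\bigcup_i F i) x by rewrite -UF.
  have [j _ Gjy] : (\bigcup_j G j) y by rewrite -UG.
  by exists (pickle (i, j)) => //; rewrite pickleK.
move=> k; case: unpickle => [[i j]|]; last by rewrite measure0.
have [mFi Fi_fin] := F_fin i; have [mGj Gj_fin] := G_fin j.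
split; first exact: measurableX.
by rewrite product_measure1E // lte_mul_pinfty // ge0_fin_numE.
Qed.

Section lebesgue_affine.
Context (R : realType).
Variables (s c : R).
Hypothesis s_gt0 : 0 < s.

Let phi : measurableTypeR R -> measurableTypeR R := fun x => s * x + c.

Let mphi : measurable_fun setT phi.
Proof. by apply: measurable_funD => //; exact: measurable_funM. Qed.

Lemma lebesgue_measure_affine (A : set R) : measurable A ->
  lebesgue_measure [set x | A (s * x + c)] = (s^-1%:E * lebesgue_measure A)%E.
Proof.
move=> mA.
suff -> : lebesgue_measure A =
    mscale (NngNum (ltW s_gt0)) (mpushforward lebesgue_measure mphi) A.
  by rewrite /mscale /pushforward /= muleA -EFinM mulVf ?gt_eqF // mul1e.
apply: lebesgue_measure_unique => //.
move=> _ [[a b] _ <-]; rewrite /= /mscale /= /pushforward.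
have -> : phi @^-1` `]a, b] = `](a - c) / s, (b - c) / s]%classic.
  apply/seteqP; split=> x; rewrite /= !in_itv /= /phi;
    by rewrite ltr_pdivrMr // ler_pdivlMr // ltrBlDr lerBrDr (mulrC x).
rewrite !lebesgue_measure_itv /= !lte_fin ltr_pM2r ?invr_gt0 // ltrD2r.
case: ifP => _; last by rewrite mule0.
by rewrite -!EFinB -EFinM; congr EFin; field; rewrite gt_eqF.
Qed.

Lemma ge0_integral_affine (g : R -> \bar R) :
  measurable_fun setT g -> (forall x, 0 <= g x)%E ->
  (\int[lebesgue_measure]_x g (s * x + c)%R =
     s^-1%:E * \int[lebesgue_measure]_x g x)%E.
Proof.
move=> mg g0; have sV_ge0 : 0 <= s^-1 by rewrite invr_ge0 ltW.
have := ge0_integral_pushforward mphi lebesgue_measure measurableT mg (fun y _ => g0 y).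
rewrite preimage_setT => <-.
rewrite (eq_measure_integral (mscale (NngNum sV_ge0) lebesgue_measure)).
  by rewrite ge0_integral_mscale.
by move=> A mA _; exact: lebesgue_measure_affine.
Qed.

End lebesgue_affine.

Section mcons.
Context d (T : measurableType d) (R : realType) (n : nat).
Variables (m1 : {sigma_finite_measure set T -> \bar R}).
Variables (m2 : {sigma_finite_measure set (n.-tuple T) -> \bar R}).

Definition tuple_of_pair (p : T * n.-tuple T) : n.+1.-tuple T :=
  [the n.+1.-tuple T of p.1 :: p.2].

Lemma measurable_tuple_of_pair : measurable_fun setT tuple_of_pair.
Proof. by apply: measurable_cons; [exact: measurable_fst|exact: measurable_snd]. Qed.

Definition mcons : set (n.+1.-tuple T) -> \bar R :=
  pushforward (m1 \x m2)%E tuple_of_pair.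

HB.instance Definition _ :=
  Measure.copy mcons (mpushforward (m1 \x m2)%E measurable_tuple_of_pair).

Let mcons_sigma_finite : sigma_finite setT mcons.
Proof.
have m_head_tail : measurable_fun setT
    (fun x : n.+1.-tuple T => (thead x, [tuple of behead x])).
  by apply: measurable_fun_pair; [exact: measurable_tnth|exact: measurable_behead].
apply: (sigma_finite_pushforward measurable_tuple_of_pair m_head_tail).
  by move=> [x t]; congr (_, _); apply: val_inj.
exact: sigma_finite_product_measure.
Qed.

HB.instance Definition _ := Measure_isSigmaFinite.Build _ _ _ mcons mcons_sigma_finite.

End mcons.

Section lebesgue_tuple.
Context (R : realType).
Local Notation tupleR n := (n.-tuple (measurableTypeR R)).

Definition tuple_affine n (s : R) (c x : tupleR n) : tupleR n :=
  [tuple s * tnth x i + tnth c i | i < n].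

Definition tuple_cube n (a b : R) : set (tupleR n) :=
  [set x | forall i, a <= tnth x i <= b].

Lemma measurable_tuple_cube n a b : measurable (tuple_cube a b : set (tupleR n)).
Proof.
rewrite (_ : tuple_cube _ _ =
    \bigcap_(i in [set: 'I_n]) ((fun x : tupleR n => tnth x i) @^-1` `[a, b]%classic)).
  apply: fin_bigcap_measurable => // i _; rewrite -[X in measurable X]setTI.
  exact: measurable_tnth.
apply/seteqP; split=> [x xab i _|x xab i]; rewrite /= ?in_itv /=; first exact: xab.
by have := xab i I; rewrite /= in_itv.
Qed.

Fixpoint lebesgue_tuple (n : nat) : {sigma_finite_measure set (tupleR n) -> \bar R} :=
  match n with
  | 0 => \d_[tuple]
  | k.+1 => mcons lebesgue_measure (lebesgue_tuple k)
  end.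

Lemma lebesgue_tuple_cube n (a b : R) : a <= b ->
  lebesgue_tuple n (tuple_cube a b) = ((b - a) ^+ n)%:E.
Proof.
move=> ab; elim: n => [|n IHn].
  by rewrite /= expr0 diracE mem_set // => -[].
rewrite /= /mcons /pushforward (_ : _ @^-1` _ = `[a, b]%classic `*` tuple_cube a b).
  rewrite product_measure1E //; last exact: measurable_tuple_cube.
  rewrite [X in (X * _)%E]lebesgue_measure_itv /= lte_fin IHn exprS.
  case: ltP => [_|ba]; first by rewrite -EFinB -EFinM.
  by rewrite (@le_anti _ _ a b) ?ab ?ba // subrr !mul0r mul0e.
apply/seteqP; split=> [[x t] xab|[x t] /= [xab tab] i]; rewrite /= ?in_itv /=.
  split; first exact: (xab ord0).
  by move=> i; have := xab (lift ord0 i); rewrite tnthS.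
case: (unliftP ord0 i) => [j ->|->]; first by rewrite tnthS; exact: tab.
by move: xab; rewrite in_itv.
Qed.

Lemma tuple_affine_cons n s (c : tupleR n.+1) x t :
  tuple_affine s c (tuple_of_pair (x, t)) =
  tuple_of_pair (s * x + tnth c ord0, tuple_affine s [tuple of behead c] t).
Proof.
apply: eq_from_tnth => i; case: (unliftP ord0 i) => [j ->|->].
  rewrite tnth_mktuple !tnthS tnth_mktuple tnth_behead; congr (_ + tnth _ _).
  by apply: val_inj; rewrite /= inordK ?ltnS.
by rewrite tnth_mktuple.
Qed.

Lemma lebesgue_tuple_affine n s (c : tupleR n) A : 0 < s -> measurable A ->
  lebesgue_tuple n (tuple_affine s c @^-1` A) =
  ((s^-1 ^+ n)%:E * lebesgue_tuple n A)%E.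
Proof.
move=> s_gt0; elim: n c A => [|n IHn] c A mA.
  rewrite /= expr0 mul1e !diracE (_ : _ @^-1` A = A) //.
  by apply/seteqP; split=> x; rewrite /= (tuple0 (tuple_affine _ _ _)) (tuple0 x).
rewrite /= /mcons /pushforward /product_measure1 /=.
have mA' : measurable (@tuple_of_pair _ _ n @^-1` A).
  by rewrite -[X in measurable X]setTI; exact: measurable_tuple_of_pair.
pose g x := lebesgue_tuple n (xsection (@tuple_of_pair _ _ n @^-1` A) x).
have mg : measurable_fun setT g by exact: measurable_fun_xsection.
rewrite exprSr EFinM -muleA -(ge0_integral_affine (tnth c ord0) s_gt0 (g := g)) //.
rewrite -ge0_integralZl //; first last.
- by rewrite lee_fin exprn_ge0 // invr_ge0 ltW.
- apply: measurableT_comp => //=.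
  by apply: measurable_funD => //; exact: measurable_funM.
apply: eq_integral => x _; rewrite -(IHn [tuple of behead c]).
  congr (lebesgue_tuple n _).
  by apply/seteqP; split=> t; rewrite /xsection /= !inE /= tuple_affine_cons.
exact: measurable_xsection.
Qed.

End lebesgue_tuple.

Section euclidean.
Context (R : realType) (n : nat).
Implicit Types (x y u : 'rV[R]_n) (i : 'I_n).

Definition dotrv x y : R := \sum_(i < n) x ord0 i * y ord0 i.

Lemma mulmx_trE x y : x *m y^T = (dotrv x y)%:M.
Proof.
by rewrite [LHS]mx11_scalar mxE; congr (_%:M); apply: eq_bigr => i _; rewrite mxE.
Qed.

Lemma dotrvE x y : dotrv x y = (x *m y^T) ord0 ord0.
Proof. by rewrite mulmx_trE mxE. Qed.

Lemma dotrvBr x y u : dotrv x (y - u) = dotrv x y - dotrv x u.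
Proof. by rewrite -sumrB; apply: eq_bigr => i _; rewrite !mxE mulrBr. Qed.

Lemma dotrvZr a x y : dotrv x (a *: y) = a * dotrv x y.
Proof. by rewrite mulr_sumr; apply: eq_bigr => i _; rewrite mxE mulrCA. Qed.

Lemma dotrv_mulmx x y (A : 'M[R]_n) : dotrv (x *m A) y = dotrv x (y *m A^T).
Proof. by rewrite !dotrvE trmx_mul trmxK mulmxA. Qed.

Lemma sqr_enorm x : enorm x ^+ 2 = dotrv x x.
Proof. by rewrite sqr_sqrtr ?sumr_ge0 // => i _; exact: sqr_ge0. Qed.

Lemma enorm_ge0 x : 0 <= enorm x.
Proof. exact: sqrtr_ge0. Qed.

Lemma normr_le_enorm x i : `|x ord0 i| <= enorm x.
Proof.
rewrite -sqrtr_sqr ler_wsqrtr // (bigD1 i) //= lerDl.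
by apply: sumr_ge0 => j _; exact: sqr_ge0.
Qed.

Lemma enorm_eq0 x : (enorm x == 0) = (x == 0).
Proof.
apply/idP/eqP => [/eqP x0|->]; last first.
  by rewrite /enorm big1 ?sqrtr0 // => i _; rewrite mxE expr0n.
apply/rowP => i; apply/eqP; rewrite mxE -normr_le0 -x0; exact: normr_le_enorm.
Qed.

Lemma enormN x : enorm (- x) = enorm x.
Proof. by congr Num.sqrt; apply: eq_bigr => i _; rewrite mxE sqrrN. Qed.

Lemma enormZ a x : enorm (a *: x) = `|a| * enorm x.
Proof.
rewrite /enorm -sqrtr_sqr -sqrtrM ?sqr_ge0 // mulr_sumr.
by congr Num.sqrt; apply: eq_bigr => i _; rewrite mxE exprMn.
Qed.

Lemma sqr_enormB x y :
  enorm (x - y) ^+ 2 = enorm x ^+ 2 + enorm y ^+ 2 - 2 * dotrv x y.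
Proof.
rewrite !sqr_enorm /dotrv mulr_sumr -big_split -sumrB /=.
by apply: eq_bigr => i _; rewrite !mxE; ring.
Qed.

Lemma ler_enormB x y : (enorm (x - y) <= enorm x) = (enorm y ^+ 2 <= 2 * dotrv x y).
Proof.
rewrite -(@ler_pXn2r _ 2) ?nnegrE ?enorm_ge0 // sqr_enormB.
by rewrite -addrA gerDl subr_le0.
Qed.

Lemma dotrv_le_enorm x u : enorm u = 1 -> dotrv x u <= enorm x.
Proof.
move=> u1; have : 0 <= enorm (x - dotrv x u *: u) ^+ 2 by exact: sqr_ge0.
rewrite sqr_enormB enormZ u1 mulr1 real_normK ?num_real // dotrvZr -expr2.
move=> sqr_diff_ge0.
rewrite (le_trans (ler_norm _)) // -(@ler_pXn2r _ 2) ?nnegrE ?enorm_ge0 //.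
by rewrite real_normK ?num_real //; lra.
Qed.

Definition reach u x : R := 2 * Num.max (dotrv x u) 0.

Lemma reach_ge0 u x : 0 <= reach u x.
Proof. by rewrite mulr_ge0 // le_max lexx orbT. Qed.

Lemma reach_le u x : enorm u = 1 -> reach u x <= 2 * enorm x.
Proof.
by move=> u1; rewrite ler_pM2l // ge_max dotrv_le_enorm // enorm_ge0.
Qed.

Lemma ler_enormB_reach u x (a : R) : enorm u = 1 -> 0 <= a ->
  (enorm (x - a *: u) <= enorm x) = (a <= reach u x).
Proof.
move=> u1; rewrite ler_enormB enormZ u1 mulr1 real_normK ?num_real // dotrvZr /reach.
rewrite le_eqVlt => /predU1P[<-|a_gt0].
  by rewrite expr0n mul0r mulr0 lexx reach_ge0.
rewrite mulrCA expr2 ler_pM2l //; have [//|xu_lt0] := leP 0 (dotrv x u).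
by rewrite mulr0 !leNgt a_gt0 (lt_trans _ a_gt0) // pmulr_rlt0.
Qed.

(* At [u = 0] the inverse of [dotrv u u] is [0] and this is the identity. *)
Definition householder u : 'M[R]_n := 1%:M - (2 / dotrv u u) *: (u^T *m u).

Lemma householder_orthogonal u : householder u *m (householder u)^T = 1%:M.
Proof.
have -> : (householder u)^T = householder u.
  by rewrite linearB /= trmx1 linearZ /= trmx_mul trmxK.
rewrite /householder; set k := 2 / _.
rewrite mulmxBr mulmx1 mulmxBl mul1mx -scalemxAr -scalemxAl.
rewrite -mulmxA (mulmxA u) mulmx_trE mul_scalar_mx -scalemxAr !scalerA.
have kk : k * k * dotrv u u = k + k.
  have [uu0|uu0] := eqVneq (dotrv u u) 0; last by rewrite /k; field.
  by rewrite /k uu0 invr0 !mulr0 addr0.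
by rewrite kk scalerDl opprB addrK subrK.
Qed.

Lemma householder_swap x y : enorm x = enorm y -> x *m householder (x - y) = y.
Proof.
move=> xy; have [/subr0_eq ->|u_neq0] := eqVneq (x - y) 0.
  by rewrite subrr /householder mulmx0 scaler0 subr0 mulmx1.
have uu : dotrv (x - y) (x - y) = 2 * dotrv x (x - y).
  by rewrite -sqr_enorm sqr_enormB -xy dotrvBr -sqr_enorm; ring.
have uu_neq0 : dotrv (x - y) (x - y) != 0 by rewrite -sqr_enorm sqrf_eq0 enorm_eq0.
rewrite /householder mulmxBr mulmx1 -scalemxAr mulmxA mulmx_trE mul_scalar_mx scalerA.
by rewrite mulrAC -uu divff // scale1r opprB addrC subrK.
Qed.

Lemma enorm_orthogonal x (Q : 'M[R]_n) : Q *m Q^T = 1%:M -> enorm (x *m Q) = enorm x.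
Proof.
move=> QQ; apply/eqP; rewrite -(@eqrXn2 _ 2) ?enorm_ge0 // !sqr_enorm.
by rewrite dotrv_mulmx -mulmxA QQ mulmx1.
Qed.

End euclidean.

Section measurable_rows.
Context d (T : measurableType d) (R : realType) (n : nat).
Implicit Types x y : T -> 'rV[R]_n.

Definition measurable_coords x :=
  forall i, measurable_fun setT (fun t => x t ord0 i).

Lemma measurable_enorm x : measurable_coords x ->
  measurable_fun setT (fun t => enorm (x t)).
Proof.
move=> mx; apply: (@measurableT_comp _ _ _ _ _ _ (fun a : R => Num.sqrt a)).
  by apply: nondecreasing_measurable => // a b; exact: ler_wsqrtr.
by apply: measurable_sum => i; exact: measurable_funX.
Qed.

Lemma measurable_dotrv x y : measurable_coords x -> measurable_coords y ->
  measurable_fun setT (fun t => dotrv (x t) (y t)).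
Proof. by move=> mx my; apply: measurable_sum => i; exact: measurable_funM. Qed.

Lemma measurable_reach (u : 'rV[R]_n) x : measurable_coords x ->
  measurable_fun setT (fun t => reach u (x t)).
Proof.
move=> mx; apply: measurable_funM => //; apply: measurable_maxr => //.
by apply: measurable_dotrv => // i.
Qed.

Lemma measurable_coordsB x y : measurable_coords x -> measurable_coords y ->
  measurable_coords (fun t => x t - y t).
Proof.
move=> mx my i; under eq_fun do rewrite !mxE.
exact: measurable_funB.
Qed.

Definition random_vector x :=
  forall A : set 'rV[R]_n, <<s @open 'rV[R]_n >> A -> measurable (x @^-1` A).

Lemma random_vector_coords x : random_vector x -> measurable_coords x.
Proof.
move=> mx i; apply: (measurability _ (RGenOpens.measurableE R)) => _ [_ [a [b ->]] <-].
rewrite setTI; apply: (mx ((fun v : 'rV[R]_n => v ord0 i) @^-1` `]a, b[%classic)).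
apply: sub_sigma_algebra; apply: open_comp; last exact: interval_open.
by move=> v _; exact: coord_continuous.
Qed.

End measurable_rows.

Lemma measurable_coords_comp d d' (T : measurableType d) (T' : measurableType d')
    (R : realType) n (x : T' -> 'rV[R]_n) (h : T -> T') :
  measurable_coords x -> measurable_fun setT h -> measurable_coords (x \o h).
Proof. by move=> mx mh i; exact: (measurableT_comp (mx i) mh). Qed.

Section isotropic.
Context d (T : measurableType d) (R : realType) (n : nat).
Variables (P : probability T R) (z : T -> 'rV[R]_n).

Definition isotropic := forall Q : 'M[R]_n, Q *m Q^T = 1%:M ->
  forall A : set 'rV[R]_n, <<s @open 'rV[R]_n >> A ->
    P (z @^-1` A) = P ((fun t => z t *m Q) @^-1` A).

Lemma isotropic_dotrv_law (u v : 'rV[R]_n) (A : set (R * R)) :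
  isotropic -> enorm u = enorm v -> measurable A ->
  P [set t | A (enorm (z t), dotrv (z t) u)] =
  P [set t | A (enorm (z t), dotrv (z t) v)].
Proof.
move=> iso uv mA; pose Q := householder (v - u).
have QQ : Q *m Q^T = 1%:M by exact: householder_orthogonal.
have uQ : u *m Q^T = v.
  have vQ : v *m Q = u by exact: householder_swap.
  by rewrite -vQ -mulmxA QQ mulmx1.
pose W := g_sigma_algebraType (@open 'rV[R]_n).
have borel : <<s @open 'rV[R]_n >> [set w | A (enorm w, dotrv w u)].
  have mW : measurable_coords (idfun : W -> 'rV[R]_n) by exact: random_vector_coords.
  rewrite -[X in <<s _ >> X]setTI.
  apply: (_ : measurable_fun [set: W] (fun w : W => (enorm w, dotrv w u))) => //.
  by apply: measurable_fun_pair; [exact: measurable_enorm|exact: measurable_dotrv].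
rewrite [LHS](iso Q QQ _ borel); congr (P _).
by apply/seteqP; split=> t /=; rewrite enorm_orthogonal // dotrv_mulmx uQ.
Qed.

End isotropic.

Section tuple_ball.
Context (R : realType) (n : nat).
Local Notation tupleR := (n.-tuple (measurableTypeR R)).
Implicit Types (x : tupleR) (c : 'rV[R]_n).

Definition tuple_row x : 'rV[R]_n := \row_i tnth x i.

Lemma measurable_tuple_row : measurable_coords tuple_row.
Proof. by move=> i; under eq_fun do rewrite mxE; exact: measurable_tnth. Qed.

Definition tuple_ball c (rho : R) : set tupleR :=
  [set x | enorm (tuple_row x - c) <= rho].

Lemma measurable_tuple_ball c rho : measurable (tuple_ball c rho).
Proof.
apply: measurable_ler_set => //; apply/measurable_enorm/measurable_coordsB => [|i //].
exact: measurable_tuple_row.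
Qed.

Lemma tuple_ball_sub_cube rho : tuple_ball 0 rho `<=` tuple_cube (- rho) rho.
Proof.
move=> x xrho i; rewrite -ler_norml; apply: le_trans xrho.
by have := normr_le_enorm (tuple_row x - 0) i; rewrite !mxE subr0.
Qed.

Lemma tuple_cube_sub_ball : (0 < n)%N ->
  (tuple_cube 0 n%:R^-1 : set tupleR) `<=` tuple_ball 0 1.
Proof.
move=> n_gt0 x x_cube; rewrite /tuple_ball /= subr0.
rewrite -(@ler_pXn2r _ 2) ?nnegrE ?enorm_ge0 // sqr_enorm expr1n.
have -> : 1 = \sum_(i < n) n%:R^-1 :> R.
  by rewrite sumr_const card_ord -[RHS]mulr_natr mulVf // pnatr_eq0 -lt0n.
apply: ler_sum => i _; rewrite mxE; have /andP[xi_ge0 xi_le] := x_cube i.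
apply: (le_trans _ xi_le); rewrite ler_piMr // (le_trans xi_le) //.
by rewrite invf_le1 ?ler1n // ltr0n.
Qed.

Lemma lebesgue_tuple_ball_affine s c rho : 0 < s ->
  lebesgue_tuple R n (tuple_ball c rho) =
  ((s^-1 ^+ n)%:E * lebesgue_tuple R n (tuple_ball 0 (s * rho)))%E.
Proof.
move=> s_gt0; pose b : tupleR := [tuple - (s * c ord0 i) | i < n].
rewrite -(lebesgue_tuple_affine b) //; last exact: measurable_tuple_ball.
have rowE x : tuple_row (tuple_affine s b x) - 0 = s *: (tuple_row x - c).
  by apply/rowP => i; rewrite !mxE !tnth_mktuple; ring.
congr (lebesgue_tuple R n _); apply/seteqP.
by split=> x; rewrite /tuple_ball /= rowE enormZ gtr0_norm // ler_pM2l.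
Qed.

Hypothesis n_gt0 : (0 < n)%N.

Lemma lebesgue_tuple_unit_ball_gt0 : (0 < lebesgue_tuple R n (tuple_ball 0 1))%E.
Proof.
have cube_le : (lebesgue_tuple R n (tuple_cube 0 n%:R^-1) <=
    lebesgue_tuple R n (tuple_ball 0 1))%E.
  apply: le_measure; rewrite ?inE; [exact: measurable_tuple_cube| |].
    exact: measurable_tuple_ball.
  exact: tuple_cube_sub_ball.
apply: lt_le_trans cube_le; rewrite lebesgue_tuple_cube ?invr_ge0 // subr0 lte_fin.
by rewrite exprn_gt0 // invr_gt0 ltr0n.
Qed.

Lemma lebesgue_tuple_ball0_le rho : 0 <= rho ->
  (lebesgue_tuple R n (tuple_ball 0 rho) <= ((2 * rho) ^+ n)%:E)%E.
Proof.
move=> rho_ge0; have -> : 2 * rho = rho - (- rho) by ring.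
rewrite -lebesgue_tuple_cube ?ge0_cp //.
apply: le_measure; rewrite ?inE; [exact: measurable_tuple_ball| |].
  exact: measurable_tuple_cube.
exact: tuple_ball_sub_cube.
Qed.

Lemma lebesgue_tuple_ball c rho : 0 <= rho ->
  lebesgue_tuple R n (tuple_ball c rho) =
  ((rho ^+ n)%:E * lebesgue_tuple R n (tuple_ball 0 1))%E.
Proof.
rewrite le_eqVlt => /predU1P[<-|rho_gt0]; last first.
  rewrite (@lebesgue_tuple_ball_affine rho^-1) ?invr_gt0 // invrK.
  by rewrite mulVf ?gt_eqF.
rewrite expr0n eqn0Ngt n_gt0 mul0e; apply/eqP; rewrite eq_le measure_ge0 andbT.
rewrite (@lebesgue_tuple_ball_affine 1) // mulr0 invr1 expr1n mul1e.
by rewrite (le_trans (lebesgue_tuple_ball0_le (lexx 0))) // mulr0 expr0n eqn0Ngt n_gt0.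
Qed.

Lemma lebesgue_tuple_unit_ball_fin_num :
  lebesgue_tuple R n (tuple_ball 0 1) \is a fin_num.
Proof.
by rewrite ge0_fin_numE // (le_lt_trans (lebesgue_tuple_ball0_le ler01)) ?ltry.
Qed.

Lemma exprn_lebesgue_tuple_ball c rho : 0 <= rho ->
  (rho ^+ n)%:E = ((fine (lebesgue_tuple R n (tuple_ball 0 1)))^-1%:E *
    lebesgue_tuple R n (tuple_ball c rho))%E.
Proof.
move=> rho_ge0; rewrite (lebesgue_tuple_ball c rho_ge0).
have U_gt0 := lebesgue_tuple_unit_ball_gt0.
have U_fin := lebesgue_tuple_unit_ball_fin_num.
rewrite -[X in (_ * (_ * X))%E](fineK U_fin) muleCA -!EFinM mulVf ?mulr1 //.
by rewrite fine_eq0 // gt_eqF.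
Qed.

End tuple_ball.

HB.instance Definition _ (R : realType) := isSFinite.Build _ _ _ (@counting nat R)
  (sfinite_measure_sigma_finite (sigma_finite_counting R)).

Lemma counting_esum (R : realType) (A : set nat) :
  (@counting _ R A = \esum_(k in A) 1)%E.
Proof.
rewrite counting_dirac nneseries_esumT //.
by rewrite [RHS]esum_mkcond; apply: eq_esum => k _; rewrite diracE; case: ifP.
Qed.

Lemma counting_ge1 (R : realType) (A : set nat) k :
  A k -> (1 <= @counting _ R A)%E.
Proof.
move=> Ak; have -> : 1%E = @counting _ R [set k].
  by rewrite counting_esum esum_set1.
by apply: le_measure; rewrite ?inE // => _ ->.
Qed.

Lemma countable_enumeration (T : pointedType) (S : set T) : countable S ->
  exists J (e : nat -> T), set_bij J S e.
Proof.
by move=> /countable_bijP[J]; rewrite card_eq_sym => /card_set_bijP[e]; exists J, e.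
Qed.

Definition ball_count (R : realType) n (S : set 'rV[R]_n) (rho : R) : \bar R :=
  \esum_(l in [set l | S l /\ enorm l <= rho]) 1%E.

Lemma ball_count_enumeration (R : realType) n (S : set 'rV[R]_n) (J : set nat) e
    (rho : R) : set_bij J S e ->
  ball_count S rho = counting (J `&` [set k | enorm (e k) <= rho]).
Proof.
move=> [eJ einj esurj]; rewrite counting_esum.
apply: (@reindex_esum _ _ _ _ _ e); split.
- by move=> k [Jk ek]; split; [exact: eJ|].
- move=> k k' /set_mem[Jk _] /set_mem[Jk' _]; exact: einj (mem_set Jk) (mem_set Jk').
- by move=> l [/esurj[k Jk <-] ek]; exists k.
Qed.

Definition confusable (R : realType) n (S : set 'rV[R]_n) : set 'rV[R]_n :=
  [set y | exists2 l, S l & enorm (y - l) <= enorm y].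

Lemma measurable_confusable d (T : measurableType d) (R : realType) n
    (z : T -> 'rV[R]_n) (S : set 'rV[R]_n) :
  measurable_coords z -> countable S -> measurable (z @^-1` confusable S).
Proof.
move=> mz /countable_enumeration[J [e [eJ _ esurj]]].
rewrite (_ : _ @^-1` _ = \bigcup_(k in J) [set t | enorm (z t - e k) <= enorm (z t)]).
  apply: bigcup_measurable => k _; apply: measurable_ler_set.
    exact/measurable_enorm/measurable_coordsB.
  exact: measurable_enorm.
apply/seteqP; split=> [t [_ /esurj[k Jk <-]] tk|t [k Jk tk]]; first by exists k.
by exists (e k) => //; exact: eJ.
Qed.

Section isotropic_exchange.
Context d (T : measurableType d) (R : realType) (n : nat).
Variables (P : probability T R) (z : T -> 'rV[R]_n) (u : 'rV[R]_n) (D : set R).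
Hypotheses (mz : random_vector z) (iso : isotropic P z).
Hypotheses (u1 : enorm u = 1) (mD : measurable D).
Local Notation Z := ((fun t => enorm (z t)) @^-1` D).

Let mcz : measurable_coords z. Proof. exact: random_vector_coords. Qed.

Let mZ : measurable Z.
Proof. by rewrite -[Z]setTI; exact: measurable_enorm. Qed.

Lemma isotropic_closer (l : 'rV[R]_n) :
  P (Z `&` [set t | enorm (z t - l) <= enorm (z t)]) =
  P (Z `&` [set t | enorm l <= reach u (z t)]).
Proof.
pose A := [set p : R * R | D p.1] `&` [set p : R * R | enorm l ^+ 2 <= 2 * p.2].
have mA : measurable A.
  apply: measurableI; first by rewrite -[X in measurable X]setTI; exact: measurable_fst.
  by apply: measurable_ler_set => //; exact: measurable_funM.
have lu : enorm l = enorm (enorm l *: u).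
  by rewrite enormZ u1 mulr1 ger0_norm // enorm_ge0.
have := isotropic_dotrv_law iso lu mA; congr (P _ = P _); apply/seteqP.
  by split=> t /=; rewrite ler_enormB.
by split=> t; rewrite /= -(ler_enormB_reach _ u1) ?enorm_ge0 // ler_enormB -lu.
Qed.

Section family.
Context d' (S : measurableType d') (m : {sigma_finite_measure set S -> \bar R}).
Variables (J : set S) (x : S -> 'rV[R]_n).
Hypotheses (mJ : measurable J) (mx : measurable_coords x).

Let closer t s : Prop := enorm (z t - x s) <= enorm (z t).
Let within_reach t s : Prop := enorm (x s) <= reach u (z t).

Let measurable_closer : measurable [set p | closer p.1 p.2].
Proof.
have mz1 := measurable_coords_comp mcz measurable_fst.
have mx2 := measurable_coords_comp mx measurable_snd.
apply: measurable_ler_set; last exact: measurable_enorm.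
exact/measurable_enorm/measurable_coordsB.
Qed.

Let measurable_within_reach : measurable [set p | within_reach p.1 p.2].
Proof.
apply: measurable_ler_set.
  exact: measurable_enorm (measurable_coords_comp mx measurable_snd).
exact: measurable_reach (measurable_coords_comp mcz measurable_fst).
Qed.

Lemma measurable_fun_closer_section :
  measurable_fun Z (fun t => m (J `&` [set s | enorm (z t - x s) <= enorm (z t)])).
Proof. exact: (measurable_fun_measure_section m mZ mJ measurable_closer). Qed.

Lemma measurable_fun_reach_section :
  measurable_fun Z (fun t => m (J `&` [set s | enorm (x s) <= reach u (z t)])).
Proof. exact: (measurable_fun_measure_section m mZ mJ measurable_within_reach). Qed.

Lemma isotropic_exchange :
  (\int[P]_(t in Z) m (J `&` [set s | (enorm (z t - x s) <= enorm (z t))%R]) =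
   \int[P]_(t in Z) m (J `&` [set s | (enorm (x s) <= reach u (z t))%R]))%E.
Proof.
rewrite [LHS](integral_measure_section P m mZ mJ measurable_closer).
rewrite [RHS](integral_measure_section P m mZ mJ measurable_within_reach).
by apply: eq_integral => s _; exact: isotropic_closer.
Qed.

End family.

Lemma isotropic_moment : (0 < n)%N ->
  (\int[P]_(t in Z) (reach u (z t) ^+ n)%:E =
   \int[P]_(t in Z) (enorm (z t) ^+ n)%:E)%E.
Proof.
move=> n_gt0; set mu := lebesgue_tuple R n.
set k := (fine (mu (tuple_ball 0 1)))^-1.
have k_ge0 : (0 <= k%:E)%E by rewrite lee_fin invr_ge0 fine_ge0.
have reachE t : (reach u (z t) ^+ n)%:E =
    (k%:E * mu (setT `&` [set x | (enorm (tuple_row x) <= reach u (z t))%R]))%E.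
  rewrite (exprn_lebesgue_tuple_ball n_gt0 0) ?reach_ge0 //.
  by congr (_ * mu _)%E; rewrite setTI /tuple_ball; under eq_set do rewrite subr0.
have normE t : (enorm (z t) ^+ n)%:E = (k%:E *
    mu (setT `&` [set x | (enorm (z t - tuple_row x) <= enorm (z t))%R]))%E.
  rewrite (exprn_lebesgue_tuple_ball n_gt0 (z t)) ?enorm_ge0 //.
  congr (_ * mu _)%E; rewrite setTI /tuple_ball.
  by under eq_set do rewrite -enormN opprB.
have mrow := @measurable_tuple_row R n.
under eq_integral do rewrite reachE; under [RHS]eq_integral do rewrite normE.
rewrite !ge0_integralZl // -?isotropic_exchange //.
- exact: measurable_fun_closer_section.
- exact: measurable_fun_reach_section.
Qed.

Section union_bound.
Variable S : set 'rV[R]_n.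
Hypothesis countable_S : countable S.

Lemma measurable_ball_count_reach :
  measurable_fun Z (fun t => ball_count S (reach u (z t))).
Proof.
have [J [e e_bij]] := countable_enumeration countable_S.
under [X in measurable_fun _ X]eq_fun do rewrite (ball_count_enumeration _ e_bij).
exact: measurable_fun_reach_section.
Qed.

Lemma isotropic_union_bound :
  (P (Z `&` z @^-1` confusable S) <= \int[P]_(t in Z) ball_count S (reach u (z t)))%E.
Proof.
have [J [e e_bij]] := countable_enumeration countable_S.
have [_ _ esurj] := e_bij.
have m_confusable := measurable_confusable mcz countable_S.
under eq_integral do rewrite (ball_count_enumeration _ e_bij).
rewrite -isotropic_exchange // setIC -integral_indic //.
apply: ge0_le_integral => //.
- by apply/measurable_EFinP; exact: measurable_indic.
- exact: measurable_fun_closer_section.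
move=> t _; rewrite indicE.
have [/set_mem[l Sl tl]|_] := boolP (t \in _); last exact: measure_ge0.
by have [k Jk ekl] := esurj l Sl; apply: (@counting_ge1 _ _ k); rewrite /= ekl.
Qed.

End union_bound.

End isotropic_exchange.

Lemma countable_lattice (R : realType) n (B : 'M[R]_n) : countable (lattice B).
Proof.
apply: (@sub_countable _ _ _ [set map_mx intr v *m B | v in [set: 'rV[int]_n]]).
  apply: subset_card_le => _ [v v_int <-].
  exists (\row_i Num.floor (v ord0 i)) => //; congr (_ *m _).
  by apply/rowP => i; rewrite !mxE; exact: floorK.
exact: sub_countable (card_image_le _ _) (countableP _).
Qed.

Lemma enorm_delta_mx (R : realType) n (i : 'I_n) :
  enorm (delta_mx ord0 i : 'rV[R]_n) = 1.
Proof.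
rewrite /enorm (bigD1 i) //= big1 => [|j ji]; rewrite mxE !eqxx ?(negPf ji) /=.
  by rewrite expr1n addr0 sqrtr1.
by rewrite expr0n.
Qed.

Lemma unit_ball_vol_gt0 (R : realType) n : 0 < unit_ball_vol n :> R.
Proof.
suff : 0 < unit_ball_vol n :> R /\ 0 < unit_ball_vol n.+1 :> R by case.
elim: n => [|n [vol_n vol_n1]]; first by split; rewrite /= ?ltr01 ?ltr0n.
by split=> //; rewrite /= mulr_gt0 // divr_gt0 // mulr_gt0 // pi_gt0.
Qed.

Lemma integral_exprn (R : realType) n (t : R) : 0 < t ->
  (\int[lebesgue_measure]_(x in `]0%R, t]) (n.+1%:R * x ^+ n)%:E = (t ^+ n.+1)%:E)%E.
Proof.
move=> t_gt0; rewrite integral_itv_obnd_cbnd; last first.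
  apply/measurable_EFinP/measurable_funTS.
  by apply: measurable_funM => //; exact: measurable_funX.
rewrite (@continuous_FTC2 _ _ (fun x => x ^+ n.+1)) //.
- by rewrite expr0n sube0.
- apply: continuous_subspaceT => x; apply: cvgM; first exact: cvg_cst.
  exact: exprn_continuous.
- split.
  + by move=> x _; exact: exprn_derivable.
  + by apply: cvg_at_right_filter; exact: exprn_continuous.
  + by apply: cvg_at_left_filter; exact: exprn_continuous.
- by move=> x _; rewrite exp_derive1.
Qed.

Section lattice_count.
Context (R : realType) (n : nat) (B : 'M[R]_n).

Definition nonzero_lattice : set 'rV[R]_n := [set l | lattice B l /\ l != 0].

Lemma countable_nonzero_lattice : countable nonzero_lattice.
Proof.
by apply: sub_countable (countable_lattice B); apply: subset_card_le => l [].
Qed.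

Lemma setC_voronoi0 : ~` voronoi0 B = confusable nonzero_lattice.
Proof.
apply/seteqP; split=> y /=.
  move=> /existsNP[l /not_implyP[ll /not_implyP[l0 /negP]]].
  by rewrite -leNgt; exists l.
move=> [l [ll l0] yl] /(_ l ll l0); rewrite ltNge => /negP; exact.
Qed.

Lemma edelta_gt0 : 0 < edelta B.
Proof. exact: expR_gt0. Qed.

Lemma count_upto_edelta rho :
  count_upto B (edelta B * rho) = ball_count nonzero_lattice rho.
Proof.
congr esum; apply/seteqP; split=> l.
  by move=> [ll [l0]]; rewrite ler_pM2l ?edelta_gt0.
by move=> [[ll l0] l_rho]; do 2 split=> //; rewrite ler_pM2l ?edelta_gt0.
Qed.

Lemma count_upto0 : count_upto B 0 = 0%E.
Proof.
rewrite /count_upto (_ : [set _ | _] = set0) ?esum_set0 // -subset0 => l [_ [l0]].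
by rewrite pmulr_rle0 ?edelta_gt0 // leNgt lt_def enorm_eq0 l0 enorm_ge0.
Qed.

Hypothesis n_gt0 : (0 < n)%N.

Lemma edelta_expn : \det B != 0 -> edelta B ^+ n = lat_beta B.
Proof.
move=> B0; rewrite /edelta -expRM_natl /lat_delta mulrC divfK ?pnatr_eq0 -?lt0n //.
by rewrite lnK // posrE invr_gt0 normr_gt0.
Qed.

Section count_bound.
Variables (N' : R -> R) (L A : R).
Hypotheses (adm : admissible_Nprime B L N').
Hypothesis alpha_le : forall x, 0 < x -> x <= edelta B * L -> alpha_prime n N' x <= A.

Lemma alpha_prime_bound_ge0 : 0 < L -> 0 <= A.
Proof.
move=> L_gt0; have t_gt0 : 0 < edelta B * L by rewrite mulr_gt0 ?edelta_gt0.
apply: le_trans (alpha_le t_gt0 (lexx _)); have [_ N_ge0 _ _] := adm.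
rewrite divr_ge0 ?N_ge0 // mulr_ge0 ?exprn_ge0 ?(ltW t_gt0) //.
by rewrite mulr_ge0 // ltW // unit_ball_vol_gt0.
Qed.

Lemma count_upto_le t : 0 <= t -> t <= edelta B * L ->
  (count_upto B t <= (A * unit_ball_vol n * t ^+ n)%:E)%E.
Proof.
rewrite le_eqVlt => /predU1P[<- _|t_gt0 tL].
  by rewrite count_upto0 expr0n eqn0Ngt n_gt0 mulr0.
have A_ge0 : 0 <= A.
  apply: alpha_prime_bound_ge0.
  by rewrite -(pmulr_rgt0 _ edelta_gt0) (lt_le_trans t_gt0).
have [mN N_ge0 _ count_le] := adm; apply: (le_trans (count_le t t_gt0 tL)).
have V_gt0 := unit_ball_vol_gt0 R n.
rewrite -[in t ^+ n](prednK n_gt0) EFinM -integral_exprn // prednK //.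
have mX : measurable_fun `]0, t] (fun x : R => (n%:R * x ^+ n.-1)%:E).
  apply/measurable_EFinP/measurable_funTS.
  by apply: measurable_funM => //; exact: measurable_funX.
rewrite -ge0_integralZl //; first last.
- by rewrite lee_fin mulr_ge0 // ltW.
- move=> x /=; rewrite in_itv /= => /andP[x_gt0 _].
  by rewrite lee_fin mulr_ge0 // exprn_ge0 // ltW.
apply: ge0_le_integral => //.
- by move=> x /=; rewrite in_itv /= => /andP[x_gt0 _]; rewrite lee_fin N_ge0.
- apply/measurable_EFinP; apply: measurable_funS mN => //.
  by move=> x /=; rewrite !in_itv /= andbT => /andP[].
- exact: emeasurable_funM.
- move=> x /=; rewrite in_itv /= => /andP[x_gt0 xt]; rewrite -EFinM lee_fin.
  have := alpha_le x_gt0 (le_trans xt tL).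
  rewrite /alpha_prime ler_pdivrMr; last by rewrite !mulr_gt0 ?exprn_gt0 // ltr0n.
  by rewrite mulrA [n%:R * _]mulrC !mulrA.
Qed.

Lemma ball_count_nonzero_lattice_le rho : \det B != 0 -> 0 <= rho -> rho <= L ->
  (ball_count nonzero_lattice rho <=
   (A * (lat_beta B * unit_ball_vol n) * rho ^+ n)%:E)%E.
Proof.
move=> B0 rho_ge0 rhoL; have -> : A * (lat_beta B * unit_ball_vol n) * rho ^+ n =
    A * unit_ball_vol n * (edelta B * rho) ^+ n by rewrite exprMn edelta_expn //; ring.
rewrite -count_upto_edelta count_upto_le ?ler_pM2l ?edelta_gt0 //.
by rewrite mulr_ge0 // ltW ?edelta_gt0.
Qed.

End count_bound.

End lattice_count.

Section decoding_error.
Context (R : realType) (n : nat) (B : 'M[R]_n).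
Context d (T : measurableType d) (P : probability T R) (z : T -> 'rV[R]_n).
Variable f : R -> R.
Hypotheses (n_gt0 : (0 < n)%N) (B0 : \det B != 0).
Hypotheses (mz : random_vector z) (iso : isotropic P z).
Hypotheses (mf : measurable_fun setT f) (f_ge0 : forall x, 0 <= f x).
Hypothesis norm_density : forall S : set R, measurable S ->
  P ((fun t => enorm (z t)) @^-1` S) =
  (\int[lebesgue_measure]_(x in S) (f x)%:E)%E.
Local Notation norm_in D := ((fun t => enorm (z t)) @^-1` D).
Local Notation error := (z @^-1` (~` voronoi0 B)).

Let mcz : measurable_coords z. Proof. exact: random_vector_coords. Qed.

Let mnorm : measurable_fun setT (fun t => enorm (z t)).
Proof. exact: measurable_enorm. Qed.

Let mnorm_in (D : set R) : measurable D -> measurable (norm_in D).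
Proof. by move=> mD; rewrite -[norm_in D]setTI; exact: mnorm. Qed.

Lemma measurable_error : measurable error.
Proof.
rewrite setC_voronoi0; apply: measurable_confusable => //.
exact: countable_nonzero_lattice.
Qed.

Lemma error_le_add_tail r :
  (P error <= P (norm_in `[0%R, r] `&` error) +
   \int[lebesgue_measure]_(x in `[r, +oo[) (f x)%:E)%E.
Proof.
rewrite -norm_density //.
have m_in := measurableI _ _ (mnorm_in (measurable_itv `[0, r])) measurable_error.
have m_out := mnorm_in (measurable_itv `[r, +oo[).
apply: le_trans (measureU2 P m_in m_out); apply: le_measure; rewrite ?inE.
- exact: measurable_error.
- exact: measurableU.
- move=> t err; have [zr|/ltW rz] := leP (enorm (z t)) r.
    by left; split=> //; rewrite /= in_itv /= enorm_ge0.
  by right; rewrite /= in_itv /= rz.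
Qed.

Lemma inner_error_le N' r A : 0 < r -> admissible_Nprime B (2 * r) N' ->
  (forall x, 0 < x -> x <= 2 * edelta B * r -> alpha_prime n N' x <= A) ->
  (P (norm_in `[0%R, r] `&` error) <=
   A%:E * ((lat_beta B * unit_ball_vol n)%:E * truncated_moment f n r))%E.
Proof.
move=> r_gt0 adm; rewrite -mulrA mulrCA => alpha_le.
pose u : 'rV[R]_n := delta_mx ord0 (Ordinal n_gt0).
have u1 : enorm u = 1 by exact: enorm_delta_mx.
have mI : measurable (`[0, r]%classic : set R) by [].
have countable_S := countable_nonzero_lattice B.
have A_ge0 : 0 <= A by apply: alpha_prime_bound_ge0 adm alpha_le _; rewrite mulr_gt0.
have V_gt0 := unit_ball_vol_gt0 R n.
have mreach : measurable_fun (norm_in `[0, r]) (fun t => (reach u (z t) ^+ n)%:E).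
  by apply/measurable_EFinP/measurable_funTS/measurable_funX; exact: measurable_reach.
rewrite setC_voronoi0.
apply: le_trans (isotropic_union_bound mz iso u1 mI countable_S) _.
rewrite -(integral_truncated_moment mnorm mf f_ge0 norm_density).
rewrite -(isotropic_moment mz iso u1) // muleA -EFinM.
rewrite -ge0_integralZl //; first last.
- by rewrite lee_fin !mulr_ge0 ?invr_ge0 // ltW.
- by move=> t _; rewrite lee_fin exprn_ge0 // reach_ge0.
- exact: mnorm_in.
apply: ge0_le_integral => //.
- exact: mnorm_in.
- by move=> t _; exact: esum_ge0.
- exact: measurable_ball_count_reach.
- exact: emeasurable_funM.
move=> t /=; rewrite in_itv /= => /andP[_ zr]; rewrite -EFinM.
rewrite (ball_count_nonzero_lattice_le n_gt0 adm) ?reach_ge0 //.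
by rewrite (le_trans (reach_le _ u1)) // ler_pM2l.
Qed.

Lemma inner_error_le_sup N' r : 0 < r -> admissible_Nprime B (2 * r) N' ->
  (0 < (lat_beta B * unit_ball_vol n)%:E * truncated_moment f n r)%E ->
  (P (norm_in `[0%R, r] `&` error) <=
   ereal_sup [set (alpha_prime n N' x)%:E | x in `]0%R, (2 * edelta B * r)%R]] *
   ((lat_beta B * unit_ball_vol n)%:E * truncated_moment f n r))%E.
Proof.
move=> r_gt0 adm moment_gt0; set s := ereal_sup _.
have alpha_le x : 0 < x -> x <= 2 * edelta B * r -> ((alpha_prime n N' x)%:E <= s)%E.
  move=> x_gt0 xr; apply: ereal_sup_ubound; exists x => //=.
  by rewrite in_itv /= x_gt0.
case: s alpha_le => [A| |] alpha_le; first exact: inner_error_le adm _.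
- by rewrite gt0_mulye // leey.
- have x_gt0 : 0 < 2 * edelta B * r by rewrite !mulr_gt0 // edelta_gt0.
  by have := alpha_le _ x_gt0 (lexx _); rewrite leNgt ltNyr.
Qed.

(* [alpha_r B r] may be infinite; if the truncated moment vanishes, the right-hand
   side is then [+oo * 0 = 0], and the event is negligible. *)
Lemma inner_error_le_alpha r : 0 < r ->
  (P (norm_in `[0%R, r] `&` error) <=
   alpha_r B r * ((lat_beta B * unit_ball_vol n)%:E * truncated_moment f n r))%E.
Proof.
move=> r_gt0; have [moment0|moment_neq0] := eqVneq (truncated_moment f n r) 0%E.
  rewrite moment0 !mule0 -(truncated_moment_eq0 mf f_ge0 norm_density moment0).
  apply: le_measure; rewrite ?inE; [|exact: mnorm_in|by move=> t []].
  by apply: measurableI; [exact: mnorm_in|exact: measurable_error].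
have moment_fin : truncated_moment f n r \is a fin_num.
  exact: (truncated_moment_fin_num mnorm mf f_ge0 norm_density _ (ltW r_gt0)).
have moment_gt0 : (0 < (lat_beta B * unit_ball_vol n)%:E * truncated_moment f n r)%E.
  rewrite mule_gt0 //; last by rewrite lt0e moment_neq0 truncated_moment_ge0.
  by rewrite lte_fin mulr_gt0 ?unit_ball_vol_gt0 // invr_gt0 normr_gt0.
apply: lee_ereal_infM => // [|_ [N' adm <-]]; first by rewrite fin_numM.
exact: inner_error_le_sup.
Qed.

Lemma error_le_pe_bound r : 0 < r -> (P error <= pe_bound B f r)%E.
Proof.
move=> r_gt0; apply: le_trans (error_le_add_tail r) _.
by rewrite leeD2r // inner_error_le_alpha.
Qed.

End decoding_error.

Theorem theorem5 (R : realType) (n : nat) (B : 'M[R]_n)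
    (d : measure_display) (T : measurableType d) (P : probability T R)
    (z : T -> 'rV[R]_n) (f : R -> R) :
  (0 < n)%N ->
  \det B != 0 ->
  (* z is a random vector (Borel measurable) *)
  (forall A : set 'rV[R]_n, <<s @open 'rV[R]_n >> A -> measurable (z @^-1` A)) ->
  (* isotropy: the law of z is invariant under orthogonal maps *)
  (forall Q : 'M[R]_n, Q *m Q^T = 1%:M ->
     forall A : set 'rV[R]_n, <<s @open 'rV[R]_n >> A ->
       P (z @^-1` A) = P ((fun t => z t *m Q) @^-1` A)) ->
  (* f is a density of ||z|| *)
  measurable_fun setT f ->
  (forall x, 0 <= f x) ->
  (forall S : set R, measurable S ->
     P ((fun t => enorm (z t)) @^-1` S) =
       (\int[lebesgue_measure]_(x in S) (f x)%:E)%E) ->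
  (* the density of z is a non-increasing function of ||z||:
     rho |-> f(rho) / rho^(n-1) is non-increasing on (0, +oo) *)
  (forall x y, 0 < x -> x <= y -> f y / y ^+ n.-1 <= f x / x ^+ n.-1) ->
  (forall r, 0 < r -> (P (z @^-1` (~` voronoi0 B)) <= pe_bound B f r)%E) /\
  (P (z @^-1` (~` voronoi0 B)) <= ereal_inf [set pe_bound B f r | r in (`]0%R, +oo[ : set R)])%E.
Proof.
move=> n_gt0 B0 mz iso mf f_ge0 norm_density _.
have bound r : 0 < r -> (P (z @^-1` (~` voronoi0 B)) <= pe_bound B f r)%E.
  exact: error_le_pe_bound.
split=> //; apply/ereal_infP => _ [r + <-].
by rewrite /= in_itv /= andbT; exact: bound.
Qed.
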